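(* Let $I\subseteq\mathbb{R}[x]=\mathbb{R}[x_1,\dots,x_n]$ be a convex radical ideal and $Z=\mathcal{V}_{\mathbb{R}}(I)$ its real zero set, such that $\mathrm{conv}(Z)$ is compact and contains the origin in its interior. Then: (1) Let $p\in\mathbb{R}[x]$ be a polynomial with no zeros on $\mathrm{ext}(\mathrm{conv}(Z))$ and $w(x)\in\mathbb{R}[x]^k$ a vector of $k$ polynomials. The slack operator of $\mathrm{conv}(Z)$ has a rational factorization with $A(x)=\frac{1}{p(x)^2}w(x)w(x)^T$ in $\mathcal{S}_+^k$ for all $x\in\mathrm{ext}(\mathrm{conv}(Z))$ if and only if, for every linear polynomial $\ell(x)$ nonnegative over $Z$, $p(x)^2\ell(x)$ is a sum of squares modulo $I$ with all the polynomials in the sum of squares being linear combinations of the entries of $w(x)$. (2) For a nonnegative integer $k$, the slack operator of $\mathrm{conv}(Z)$ has a polynomial factorization with $A(x)=w(x)w(x)^T$, where the degree of each entry of $w$ is at most $k$, if and only if $\mathrm{TH}_k(I)=\mathrm{conv}(Z)$.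
   Context: $\mathcal{V}_{\mathbb{R}}(I)$ is the set of real common zeros of the polynomials in $I$. $\mathrm{ext}(\cdot)$ denotes the set of extreme points. The ideal $I$ is convex radical if $I$ equals the ideal of all polynomials in $\mathbb{R}[x]$ vanishing on $\mathcal{V}_{\mathbb{R}}(I)\cap\mathrm{ext}(\mathrm{conv}(\mathcal{V}_{\mathbb{R}}(I)))$. ''Linear polynomial'' means polynomial of degree at most one (constant term allowed). For $C=\mathrm{conv}(Z)$ the polar is $C^\circ=\{y : \langle x,y\rangle\le1\ \forall x\in C\}$, and the slack operator is $S_C:\mathrm{ext}(C)\times\mathrm{ext}(C^\circ)\to\mathbb{R}$, $S_C(x,y)=1-\langle x,y\rangle$. $\mathcal{S}_+^r$ is the cone of $r\times r$ real symmetric positive semidefinite matrices with inner product $\langle A,B\rangle=\mathrm{tr}(AB)$. An $\mathcal{S}_+^r$-factorization of $S_C$ is a pair of maps $A:\mathrm{ext}(C)\to\mathcal{S}_+^r$, $B:\mathrm{ext}(C^\circ)\to\mathcal{S}_+^r$ with $S_C(x,y)=\langle A(x),B(y)\rangle$ for all $(x,y)$. It is a rational factorization if the map $A$ has the form $A(x)=\frac{1}{p(x)^2}w(x)w(x)^T$ with $p$ a polynomial and $w$ a vector of $r$ polynomials, and a polynomial factorization if it has this form with $p=1$ (in part (2) the length $r$ of $w$ is arbitrary). A polynomial $q$ is a sum of squares modulo $I$ if there are $h_1,\dots,h_s\in\mathbb{R}[x]$ (the polynomials in the sum of squares) with $q-\sum h_i^2\in I$; it is $k$-sos modulo $I$ if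 such $h_i$ exist all of degree at most $k$. The $k$-th theta body $\mathrm{TH}_k(I)$ is the intersection of all half-spaces $\{x\in\mathbb{R}^n : \ell(x)\ge0\}$ where $\ell$ is a linear polynomial that is $k$-sos modulo $I$. *)

(* Defs.v *)
From HB Require Import structures.
From mathcomp Require Import all_boot all_order all_algebra.
(* The notations of mpoly clash with those of mathcomp-analysis, hence
   [mpoly n R] below instead of {mpoly R[n]}. *)
From mathcomp Require Import -(notations) mpoly.
From mathcomp Require Import all_classical all_reals all_analysis.
Set Implicit Arguments.
Unset Strict Implicit.
Unset Printing Implicit Defensive.
Import Order.TTheory GRing.Theory Num.Theory numFieldNormedType.Exports.

Local Open Scope classical_set_scope.
Local Open Scope ring_scope.

Section ConvexGeometry.
Context {R : realType} {n : nat}.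
Implicit Types (C Z : set 'rV[R]_n) (x y : 'rV[R]_n).

Definition convex_hull Z : set 'rV[R]_n :=
  smallest (@convex_set R 'rV[R]_n) Z.

Definition ext C : set 'rV[R]_n :=
  [set x | C x /\ forall a b (t : R), C a -> C b -> 0 < t < 1 ->
           t *: a + (1 - t) *: b = x -> a = x /\ b = x].

Definition dot x y : R := \sum_i x ord0 i * y ord0 i.

Definition polar C : set 'rV[R]_n := [set y | forall x, C x -> dot x y <= 1].

(* The slack operator of C is the restriction of this function to
   ext C x ext (polar C). *)
Definition slack x y : R := 1 - dot x y.

End ConvexGeometry.

Definition psd {R : realType} {r : nat} (M : 'M[R]_r) : Prop :=
  M^T = M /\ forall u : 'rV[R]_r, 0 <= (u *m M *m u^T) ord0 ord0.

(* The maps of a factorization only matter on ext C and on ext (polar C);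
   they are total functions unconstrained elsewhere. *)
Definition psd_factorization {R : realType} {n r : nat} (C : set 'rV[R]_n)
    (A B : 'rV[R]_n -> 'M[R]_r) : Prop :=
  [/\ forall x, ext C x -> psd (A x),
      forall y, ext (polar C) y -> psd (B y) &
      forall x y, ext C x -> ext (polar C) y -> slack x y = \tr (A x *m B y)].

Section Polynomials.
Context {R : realType} {n : nat}.
Implicit Types (p q l h : mpoly n R) (I : set (mpoly n R)).

Definition peval p (x : 'rV[R]_n) : R := meval (fun i => x ord0 i) p.

(* msize p is 1 + the total degree of p, and 0 for p = 0. *)
Definition deg_le (k : nat) p : Prop := (msize p <= k.+1)%N.

Definition linear_poly l : Prop := deg_le 1 l.

(* Unlike idealr_closed, this does not require the ideal to be proper. *)
Definition is_ideal I : Prop :=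
  I 0 /\ forall a u v, I u -> I v -> I (a * u + v).

Definition real_zeros I : set 'rV[R]_n :=
  [set x | forall p, I p -> peval p x = 0].

Definition vanishing_ideal (S : set 'rV[R]_n) : set (mpoly n R) :=
  [set p | forall x, S x -> peval p x = 0].

Definition convex_radical I : Prop :=
  I = vanishing_ideal
        (real_zeros I `&` ext (convex_hull (real_zeros I))).

Definition sos_mod I (H : set (mpoly n R)) q : Prop :=
  exists (s : nat) (h : 'I_s -> mpoly n R),
    (forall i, H (h i)) /\ I (q - \sum_i h i ^+ 2).

Definition ksos_mod (k : nat) I q : Prop := sos_mod I (deg_le k) q.

Definition theta_body (k : nat) I : set 'rV[R]_n :=
  \bigcap_(l in [set l | linear_poly l /\ ksos_mod k I l])
     [set x | 0 <= peval l x].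

Definition lin_combs {r : nat} (w : 'I_r -> mpoly n R) : set (mpoly n R) :=
  [set h | exists c : 'I_r -> R, h = \sum_j c j *: w j].

Definition vec_eval {r : nat} (w : 'I_r -> mpoly n R) (x : 'rV[R]_n) :
    'cV[R]_r :=
  \col_j peval (w j) x.

Definition has_rational_factorization {r : nat} (C : set 'rV[R]_n) p
    (w : 'I_r -> mpoly n R) : Prop :=
  exists A B : 'rV[R]_n -> 'M[R]_r,
    psd_factorization C A B /\
    forall x, ext C x ->
      A x = (peval p x ^+ 2)^-1 *: (vec_eval w x *m (vec_eval w x)^T).

Definition has_polynomial_factorization {r : nat} (C : set 'rV[R]_n)
    (w : 'I_r -> mpoly n R) : Prop :=
  has_rational_factorization C 1 w.

End Polynomials.

(* Main.v *)
Require Import Defs.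
From HB Require Import structures.
From mathcomp Require Import all_boot all_order all_algebra.
From mathcomp Require Import -(notations) mpoly.
From mathcomp Require Import all_classical all_reals all_analysis.
From mathcomp Require Import ring lra.
Import Order.TTheory GRing.Theory Num.Theory numFieldNormedType.Exports.
Local Open Scope classical_set_scope.
Local Open Scope ring_scope.
Set Implicit Arguments.
Unset Strict Implicit.
Unset Printing Implicit Defensive.

(** Given [p] and [w], let [K] be the set of [y] such that [p^2 (1 - <x, y>)]
    equals, on [ext C], a quadratic form [w(x) Q w(x)^T] with [Q] positive
    semidefinite, i.e. is modulo [I] a sum of squares of linear combinations
    of [w].  A factorization says [ext (polar C)] is contained in [K]; since
    every linear polynomial nonnegative on [Z] is a multiple of some
    [1 - <x, y>] with [y] in [polar C], the sum-of-squares condition says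
    [polar C] is contained in [K].  The two are equivalent because [K] is
    closed and convex: a point of [polar C] outside [K] could be strictly
    separated from [K] by a linear functional, whose maximum over the compact
    set [polar C] is attained at an extreme point.  For (2), take for [w] all
    monomials of degree at most [k]: bipolar duality between [K] and the theta
    body, together with separation of points from the compact convex set [C],
    gives the equivalence. *)

Import Order.TTheory GRing.Theory Num.Theory numFieldNormedType.Exports.
Local Open Scope classical_set_scope.
Local Open Scope ring_scope.

(** * Convex sets, the inner product and separation of points from compact convex sets *)

Lemma convex_setE (R : realType) n (A : set 'rV[R]_n) :
  convex_set A <-> forall x y t, A x -> A y -> 0 <= t <= 1 ->
    A (t *: x + (1 - t) *: y).
Proof.
split=> [cA x y t Ax Ay /andP[t0 t1]|cA x y l].
  by have := cA x y (Itv01 t0 t1); rewrite !inE; apply.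
rewrite !inE => Ax Ay; apply: cA => //.
by apply/andP; split.
Qed.

Lemma dotC (R : realType) n (x y : 'rV[R]_n) : dot x y = dot y x.
Proof. by apply: eq_bigr => i _; rewrite mulrC. Qed.

Lemma dot_linear (R : realType) n (x : 'rV[R]_n) : linear_for *%R (dot x).
Proof.
move=> a u v; rewrite /dot mulr_sumr -big_split /=; apply: eq_bigr => i _.
rewrite !mxE; ring.
Qed.

HB.instance Definition _ (R : realType) n (x : 'rV[R]_n) :=
  GRing.isLinear.Build R 'rV[R]_n R *%R (dot x) (dot_linear x).

Lemma dotDr (R : realType) n (x y z : 'rV[R]_n) :
  dot x (y + z) = dot x y + dot x z.
Proof. exact: linearD. Qed.

Lemma dotZr (R : realType) n (x y : 'rV[R]_n) a : dot x (a *: y) = a * dot x y.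
Proof. exact: linearZ. Qed.

Lemma dot0r (R : realType) n (x : 'rV[R]_n) : dot x 0 = 0.
Proof. exact: linear0. Qed.

Lemma dotNr (R : realType) n (x y : 'rV[R]_n) : dot x (- y) = - dot x y.
Proof. exact: linearN. Qed.

Lemma dotDl (R : realType) n (x y z : 'rV[R]_n) :
  dot (y + z) x = dot y x + dot z x.
Proof. by rewrite dotC dotDr !(dotC x). Qed.

Lemma dotZl (R : realType) n (x y : 'rV[R]_n) a : dot (a *: y) x = a * dot y x.
Proof. by rewrite dotC dotZr dotC. Qed.

Lemma dotNl (R : realType) n (x y : 'rV[R]_n) : dot (- y) x = - dot y x.
Proof. by rewrite dotC dotNr dotC. Qed.

Lemma dot_delta (R : realType) n (x : 'rV[R]_n) i :
  dot x (delta_mx ord0 i) = x ord0 i.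
Proof.
rewrite /dot (bigD1 i) //= big1 ?addr0 ?mxE ?eqxx ?mulr1 // => j ji.
by rewrite mxE (negbTE ji) mulr0.
Qed.

Lemma dotxx_ge0 (R : realType) n (x : 'rV[R]_n) : 0 <= dot x x.
Proof. by apply: sumr_ge0 => i _; rewrite -expr2 sqr_ge0. Qed.

Lemma dotxx_eq0 (R : realType) n (x : 'rV[R]_n) : (dot x x == 0) = (x == 0).
Proof.
apply/eqP/eqP => [|->]; last exact: dot0r.
move=> /psumr_eq0P h; apply/rowP => i; rewrite mxE.
by apply/eqP; rewrite -sqrf_eq0 expr2 h // => j _; rewrite -expr2 sqr_ge0.
Qed.

(** Expansion along the canonical basis writes [f] as a finite sum of multiples of coordinates. *)
Lemma linear_continuous_rV (R : realType) n (f : 'rV[R]_n -> R) :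
  linear_for *%R f -> continuous f.
Proof.
move=> lf; pose g := GRing.isLinear.Build _ _ _ _ _ lf.
have -> : f = fun x => \sum_i x ord0 i * f (delta_mx ord0 i).
  apply/funext => x; rewrite [in LHS](row_sum_delta x).
  pose F : {linear 'rV[R]_n -> R | *%R} := HB.pack f g.
  by rewrite -[f _]/(F _) linear_sum; apply: eq_bigr => i _; rewrite linearZ.
apply: continuous_big; first exact: add_continuous.
move=> i _ x.
apply: continuousM; [exact: coord_continuous|exact: cst_continuous].
Qed.

Lemma convex_halfspace (R : realType) n (a : 'rV[R]_n) b :
  convex_set [set x : 'rV[R]_n | dot a x <= b].
Proof.
apply/convex_setE => x y t /= hx hy /andP[t0 t1].
rewrite dotDr !dotZr.
have := ler_wpM2l t0 hx.
have := ler_wpM2l (_ : 0 <= 1 - t) hy; rewrite subr_ge0 => /(_ t1); lra.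
Qed.

Lemma convex_hull_convex (R : realType) n (Z : set 'rV[R]_n) :
  convex_set (convex_hull Z).
Proof.
apply/convex_setE => x y t Cx Cy t01 A [cA ZA].
move/convex_setE: (cA); apply=> //; [exact: (Cx A)|exact: (Cy A)].
Qed.

Lemma sub_convex_hull (R : realType) n (Z : set 'rV[R]_n) :
  Z `<=` convex_hull Z.
Proof. exact: sub_smallest. Qed.

Lemma convex_hull_sub (R : realType) n (Z A : set 'rV[R]_n) :
  convex_set A -> Z `<=` A -> convex_hull Z `<=` A.
Proof. exact: smallest_sub. Qed.

(* Removing an extreme point from a convex set leaves a convex set. *)
Lemma ext_convex_hull (R : realType) n (Z : set 'rV[R]_n) :
  ext (convex_hull Z) `<=` Z.
Proof.
move=> x [Cx xext]; apply: contrapT => nZx.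
suff /(_ x Cx)[_ /(_ erefl)] : convex_hull Z `<=` convex_hull Z `\ x by [].
apply: convex_hull_sub => [|z Zz]; last first.
  by split; [exact: sub_convex_hull|move=> /= zx; apply: nZx; rewrite -zx].
apply/convex_setE => a b t [Ca /= ax] [Cb /= bx] /andP[t0 t1].
split.
  have /convex_setE hC := @convex_hull_convex R n Z.
  by apply: hC; rewrite ?t0.
have [t0' | t_gt0] := leP t 0.
  have -> : t = 0 by lra.
  by rewrite scale0r add0r subr0 scale1r.
have [t1' | t_lt1] := leP 1 t.
  have -> : t = 1 by lra.
  by rewrite subrr scale0r addr0 scale1r.
move=> /= e; apply: ax.
by have [|//] := xext a b t Ca Cb _ e; rewrite t_gt0.
Qed.

Lemma dot_subZ (R : realType) n (a d : 'rV[R]_n) t :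
  dot (a - t *: d) (a - t *: d) = dot a a - 2 * t * dot a d + t ^+ 2 * dot d d.
Proof.
rewrite !dotDr !dotDl !dotNr !dotNl !dotZr !dotZl (dotC d a); ring.
Qed.

(* The first-order optimality condition at the nearest point of K. *)
Lemma nearest_point_separation (R : realType) n (K : set 'rV[R]_n)
    (y k : 'rV[R]_n) :
  convex_set K -> K k -> ~ K y ->
  (forall z, K z -> dot (y - k) (y - k) <= dot (y - z) (y - z)) ->
  exists (a : 'rV[R]_n) b, b < dot a y /\ forall z, K z -> dot a z <= b.
Proof.
move=> /convex_setE cK Kk nKy kmin; pose a := y - k.
have a_gt0 : 0 < dot a a.
  rewrite lt_def dotxx_ge0 dotxx_eq0 subr_eq0 andbT.
  by apply/eqP => yk; apply: nKy; rewrite yk.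
exists a, (dot a k); split.
  by rewrite -subr_gt0 -dotNr -dotDr.
move=> z Kz; rewrite leNgt; apply/negP => kz.
pose d := z - k; have ad : 0 < dot a d by rewrite dotDr dotNr subr_gt0.
have d0 := dotxx_ge0 d.
have key t : 0 <= t <= 1 -> 2 * t * dot a d <= t ^+ 2 * dot d d.
  move=> t01; have := kmin _ (cK _ _ _ Kz Kk t01).
  have -> : y - (t *: z + (1 - t) *: k) = a - t *: d.
    by apply/rowP => i; rewrite !mxE; ring.
  rewrite -/a dot_subZ; lra.
(* The value [t = s] violates [key]: [s^2 <d, d>] equals [s (1 - s) <a, d>], which is less than
   [2 s <a, d>]. The term [dot a d] in the denominator keeps it positive and [s] at most 1. *)
pose s := dot a d / (dot a d + dot d d).
have s_gt0 : 0 < s by rewrite divr_gt0 // ltr_pwDl.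
have sE : s * (dot a d + dot d d) = dot a d.
  by rewrite divfK // gt_eqF // ltr_pwDl.
have s_le1 : s <= 1 by rewrite ler_pdivrMr ?ltr_pwDl // mul1r lerDl.
have := key s; rewrite ltW // s_le1 => /(_ isT).
have -> : s ^+ 2 * dot d d = s * dot a d - s ^+ 2 * dot a d.
  by rewrite -[X in s * X - _]sE; ring.
have : 0 < s * dot a d by rewrite mulr_gt0.
have : 0 < s ^+ 2 * dot a d by rewrite mulr_gt0 ?exprn_gt0.
lra.
Qed.

Lemma continuous_sqdist (R : realType) (T : topologicalType) n (y : 'rV[R]_n)
    (f : T -> 'rV[R]_n) :
  (forall i, continuous (fun z => f z ord0 i)) ->
  continuous (fun z => dot (y - f z) (y - f z)).
Proof.
move=> cf; apply: continuous_big; first exact: add_continuous.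
move=> i _.
have h : continuous (fun z => (y - f z) ord0 i).
  rewrite [X in continuous X](_ : _ = fun z => y ord0 i - f z ord0 i).
    by move=> z; apply: continuousB; [exact: cst_continuous|exact: cf].
  by apply/funext => z; rewrite !mxE.
by move=> z; apply: continuousM; exact: h.
Qed.

Lemma compact_convex_separation (R : realType) n (K : set 'rV[R]_n)
    (y : 'rV[R]_n) :
  compact K -> convex_set K -> ~ K y ->
  exists (a : 'rV[R]_n) b, b < dot a y /\ forall z, K z -> dot a z <= b.
Proof.
move=> coK cK nKy.
have [K0|/set0P/negP/negPn/eqP K0] := pselect (K !=set0);
  last first.
  (* On the empty set the zero functional with bound -1 separates. *)
  by exists 0, (-1); rewrite K0 dotC dot0r; split=> //; rewrite ltrN10.
have [|k Kk kmin] := compact_EVT_min K0 coK (_ :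
    {within K, continuous (fun z : 'rV[R]_n => dot (y - z) (y - z))}).
  apply/continuous_subspaceT/(@continuous_sqdist _ _ _ y id) => i.
  exact: coord_continuous.
apply: (@nearest_point_separation _ _ K y k) => //; first by rewrite inE in Kk.
by move=> z Kz; apply: kmin; rewrite inE.
Qed.

(** * Extreme points of compact convex sets *)

Lemma dot_continuous (R : realType) n (a : 'rV[R]_n) : continuous (dot a).
Proof. exact/linear_continuous_rV/dot_linear. Qed.

Lemma closed_halfspace (R : realType) n (a : 'rV[R]_n) b :
  closed [set x : 'rV[R]_n | dot a x <= b].
Proof.
have /continuous_closedP/(_ _ (@closed_le _ b)) := @dot_continuous R n a.
exact.
Qed.

Lemma compact_rV_box (R : realType) n (A : set 'rV[R]_n) M :
  closed A -> (forall x i, A x -> `|x ord0 i| <= M) -> compact A.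
Proof.
move=> clA bA.
have := @rV_compact R n (fun=> `[- M, M]%classic) (fun=> @segment_compact _ _ _).
move=> /(subclosed_compact clA); apply=> x Ax i /=.
by rewrite in_itv /= -ler_norml bA.
Qed.

Lemma closed_polar (R : realType) n (C : set 'rV[R]_n) : closed (polar C).
Proof.
have -> : polar C = \bigcap_(x in C) [set y | dot x y <= 1] by [].
by apply: closed_bigI => x _; exact: closed_halfspace.
Qed.

Lemma interior0_box (R : realType) n (C : set 'rV[R]_n) :
  interior C 0 ->
  exists2 e, 0 < e & forall x : 'rV[R]_n, (forall i, `|x ord0 i| <= e) -> C x.
Proof.
(* The ball of radius [e] is open while the box is closed, hence the halving. *)
move=> /nbhs_ballP[e /= e0 eC]; exists (e / 2); first by rewrite divr_gt0.
move=> x xe; apply: eC; split=> // i j; rewrite (ord1 i) mxE /ball /= sub0r normrN.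
by rewrite (le_lt_trans (xe j)) // ltr_pdivrMr // ltr_pMr // ltr1n.
Qed.

Lemma normr_delta (R : realType) n i j e :
  0 <= e -> `|(e *: delta_mx ord0 i : 'rV[R]_n) ord0 j| <= e.
Proof.
move=> e0; rewrite !mxE eqxx /= normrM (ger0_norm e0).
by case: (j == i); rewrite ?normr1 ?mulr1 // normr0 mulr0.
Qed.

(** The vectors [e] and [-e] times a basis vector lie in [C] for a small [e]; testing [y] against
    them bounds each of its coordinates by [e^-1]. *)
Lemma compact_polar (R : realType) n (C : set 'rV[R]_n) :
  interior C 0 -> compact (polar C).
Proof.
move=> /interior0_box[e e0 eC].
apply: (@compact_rV_box _ _ _ e^-1); first exact: closed_polar.
move=> y i Cy; have h s : `|s| = 1 -> s * y ord0 i <= e^-1.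
  move=> s1; have := Cy (s *: (e *: delta_mx ord0 i)).
  rewrite !dotZl dotC dot_delta mulrCA -ler_pdivlMl // mulr1; apply.
  by apply: eC => j; rewrite mxE normrM s1 mul1r normr_delta // ltW.
have := h 1; have := h (-1); rewrite normrN normr1 mulN1r mul1r ler_norml.
by move=> /(_ erefl) h1 /(_ erefl) ->; rewrite lerNl h1.
Qed.

(** Extreme points are the one-point faces: [face D [set x]] amounts to [ext D x]. *)
Definition face (R : realType) n (D F : set 'rV[R]_n) :=
  F `<=` D /\ forall a b (t : R), D a -> D b -> 0 < t < 1 ->
    F (t *: a + (1 - t) *: b) -> F a /\ F b.

Definition argmax_dot (R : realType) n (a : 'rV[R]_n) (F : set 'rV[R]_n) :=
  F `&` [set x | forall z, F z -> dot a z <= dot a x].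

Lemma compact_argmax_dot (R : realType) n (a : 'rV[R]_n) (F : set 'rV[R]_n) :
  compact F -> compact (argmax_dot a F).
Proof.
move=> coF; apply: compact_closedI => //.
have -> : [set x | forall z, F z -> dot a z <= dot a x] =
    \bigcap_(z in F) [set x | dot (- a) x <= - dot a z].
  by apply/seteqP; split=> x h z /h /=; rewrite dotNl lerN2.
by apply: closed_bigI => z _; exact: closed_halfspace.
Qed.

Lemma argmax_dot_neq0 (R : realType) n (a : 'rV[R]_n) (F : set 'rV[R]_n) :
  compact F -> F !=set0 -> argmax_dot a F !=set0.
Proof.
move=> coF F0; have [|x Fx xmax] :=
  compact_EVT_max F0 coF (_ : {within F, continuous (dot a)}).
  exact/continuous_subspaceT/dot_continuous.
by exists x; split; [rewrite inE in Fx|move=> z Fz; apply: xmax; rewrite inE].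
Qed.

(** A proper average of two values reaches their upper bound only if both values do. *)
Lemma face_argmax_dot (R : realType) n (a : 'rV[R]_n) (D F : set 'rV[R]_n) :
  face D F -> face D (argmax_dot a F).
Proof.
move=> [FD Fface]; split=> [x [/FD]//|b c t Db Dc t01 [Fbc bcmax]].
have [Fb Fc] := Fface _ _ _ Db Dc t01 Fbc.
have /andP[t0 t1] := t01.
have := bcmax b Fb; have := bcmax c Fc; rewrite /= dotDr !dotZr => hc hb.
have cb : dot a c <= dot a b by rewrite -(ler_pM2l t0); lra.
have bc : dot a b <= dot a c.
  by rewrite -(@ler_pM2l _ (1 - t)) ?subr_gt0 //; lra.
have e : dot a b = dot a c by apply/le_anti; rewrite bc cb.
split; split=> // z /bcmax; rewrite /= dotDr !dotZr e; lra.
Qed.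

(** Starting from the face where [a] is maximal, each coordinate is maximized in turn over the face
    obtained so far. On the last face all coordinates are constant, so it is a single point, which
    is extreme in [D]. *)
Lemma ext_argmax_dot (R : realType) n (a : 'rV[R]_n) (D : set 'rV[R]_n) :
  compact D -> D !=set0 ->
  exists2 x, ext D x & forall z, D z -> dot a z <= dot a x.
Proof.
move=> coD D0.
have [F [faceF coF [x Fx] Fa Fs]] : exists F, [/\ face D F, compact F, F !=set0,
    F `<=` argmax_dot a D &
    forall i, i \in enum 'I_n -> forall x y, F x -> F y -> x ord0 i = y ord0 i].
  elim: (enum 'I_n) => [|i s [F [faceF coF F0 Fa Fs]]].
    exists (argmax_dot a D); split=> //.
    - by apply: face_argmax_dot; split=> // b c t.
    - exact: compact_argmax_dot.
    - exact: argmax_dot_neq0.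
  exists (argmax_dot (delta_mx ord0 i) F); split.
  - exact: face_argmax_dot.
  - exact: compact_argmax_dot.
  - exact: argmax_dot_neq0.
  - by move=> x [/Fa].
  - move=> j; rewrite inE => /orP[/eqP->|js] x y [Fx xmax] [Fy ymax]; last first.
      exact: Fs js _ _ Fx Fy.
    have := xmax _ Fy; have := ymax _ Fx; rewrite !(dotC (delta_mx _ _)) !dot_delta.
    by move=> xy yx; apply/le_anti; rewrite xy yx.
have Fx_eq y : F y -> y = x.
  by move=> Fy; apply/rowP => i; apply: (Fs i) => //; rewrite mem_enum.
exists x; last by move=> z Dz; have [_] := Fa _ Fx; apply.
split=> [|b c t Db Dc t01 e]; first exact: (proj1 faceF).
rewrite -e in Fx.
have [/Fx_eq bx /Fx_eq cx] := proj2 faceF b c t Db Dc t01 Fx.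
by [].
Qed.

(** * Positive semidefinite matrices *)

Definition qform (R : realType) r (Q : 'M[R]_r) (u : 'rV[R]_r) : R :=
  (u *m Q *m u^T) ord0 ord0.

Lemma qform_sum_outer (R : realType) r s (c : 'I_s -> 'rV[R]_r) u :
  qform (\sum_i (c i)^T *m c i) u = \sum_i dot (c i) u ^+ 2.
Proof.
rewrite /qform mulmx_sumr mulmx_suml summxE; apply: eq_bigr => i _.
have dotE (x y : 'rV[R]_r) : x *m y^T = (dot x y)%:M.
  apply/matrixP => a b; rewrite !ord1 !mxE eqxx mulr1n.
  by apply: eq_bigr => k _; rewrite mxE.
rewrite mulmxA -(mulmxA _ (c i)) !dotE mul_scalar_mx mxE mxE eqxx dotC expr2.
by rewrite mulr1n dotC.
Qed.

Lemma psd_sum_outer (R : realType) r s (c : 'I_s -> 'rV[R]_r) :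
  psd (\sum_i (c i)^T *m c i).
Proof.
split=> [|u].
  by rewrite linear_sum; apply: eq_bigr => i _; rewrite /= trmx_mul trmxK.
rewrite -/(qform _ u) qform_sum_outer.
by apply: sumr_ge0 => i _; exact: sqr_ge0.
Qed.

Lemma psd_congr (R : realType) r s (Q : 'M[R]_r) (X : 'M[R]_(s, r)) :
  psd Q -> psd (X *m Q *m X^T).
Proof.
move=> [Qs Qpos]; split=> [|u]; first by rewrite !trmx_mul trmxK Qs mulmxA.
by have := Qpos (u *m X); rewrite trmx_mul !mulmxA.
Qed.

Lemma psdD (R : realType) r (P Q : 'M[R]_r) : psd P -> psd Q -> psd (P + Q).
Proof.
move=> [Ps P0] [Qs Q0]; split=> [|u]; first by rewrite linearD /= Ps Qs.
by rewrite mulmxDr mulmxDl mxE addr_ge0.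
Qed.

Lemma psdZ (R : realType) r a (Q : 'M[R]_r) : 0 <= a -> psd Q -> psd (a *: Q).
Proof.
move=> a0 [Qs Q0]; split=> [|u]; first by rewrite linearZ /= Qs.
by rewrite -scalemxAr -scalemxAl mxE mulr_ge0.
Qed.

Lemma qformD_delta (R : realType) r (Q : 'M[R]_r) u i t : Q^T = Q ->
  qform Q (u + t *: delta_mx ord0 i) =
    qform Q u + 2 * t * dot (row i Q) u + t ^+ 2 * Q i i.
Proof.
move=> Qs; rewrite /qform raddfD /= [(t *: _)^T]linearZ /= trmx_delta.
rewrite !mulmxDl !mulmxDr -!scalemxAl -!scalemxAr -rowE -!colE.
have e1 : (row i Q *m u^T) ord0 ord0 = dot (row i Q) u.
  by rewrite mxE; apply: eq_bigr => k _; rewrite !mxE.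
have e2 : (col i (u *m Q)) ord0 ord0 = dot (row i Q) u.
  rewrite !mxE; apply: eq_bigr => k _; rewrite mxE mulrC.
  by rewrite -[in LHS]Qs mxE.
have addE (A B : 'M[R]_1) : (A + B) ord0 ord0 = A ord0 ord0 + B ord0 ord0.
  by rewrite mxE.
have scaleE a (A : 'M[R]_1) : (a *: A) ord0 ord0 = a * A ord0 ord0.
  by rewrite mxE.
rewrite !addE !scaleE e1 e2 [col _ _ _ _]mxE [row _ _ _ _]mxE; ring.
Qed.

Lemma qform_delta (R : realType) r (Q : 'M[R]_r) i :
  qform Q (delta_mx ord0 i) = Q i i.
Proof. by rewrite /qform trmx_delta -rowE -colE !mxE. Qed.

(** This is the form restricted to the line [e_j + t e_i]; suitable values of [t] give the sign of
    the diagonal, the effect of a zero diagonal entry and the bound on all entries. *)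
Lemma psd_qform_delta (R : realType) r (Q : 'M[R]_r) i j t : psd Q ->
  0 <= Q j j + 2 * t * Q i j + t ^+ 2 * Q i i.
Proof.
move=> [Qs /(_ (delta_mx ord0 j + t *: delta_mx ord0 i))].
by rewrite -/(qform _ _) qformD_delta // qform_delta dot_delta mxE.
Qed.

Lemma psd_diag_eq0 (R : realType) r (Q : 'M[R]_r) i j : psd Q ->
  Q i i = 0 -> Q i j = 0.
Proof.
move=> psdQ Qii; apply/eqP; apply: contraT => Qij.
(* With [Q i i = 0] the quadratic is affine in [t] with nonzero slope; this [t] gives it the value
   -1. *)
have := psd_qform_delta i j (- (Q j j + 1) / (2 * Q i j)) psdQ.
have -> : 2 * (- (Q j j + 1) / (2 * Q i j)) * Q i j = - (Q j j + 1) by field.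
rewrite Qii mulr0; lra.
Qed.

(** The Schur complement at the pivot [Q i i], kept at full size: one step of symmetric Gaussian
    elimination. *)
Definition schur_pivot (R : realType) r (Q : 'M[R]_r) i : 'M[R]_r :=
  Q - (Q i i)^-1 *: ((row i Q)^T *m row i Q).

Lemma schur_pivotE (R : realType) r (Q : 'M[R]_r) i a b :
  schur_pivot Q i a b = Q a b - (Q i i)^-1 * (Q i a * Q i b).
Proof. by rewrite !mxE big_ord1 !mxE. Qed.

(* With [0^-1 = 0] this also covers the pivot [Q i i = 0]. *)
Lemma psd_schur_pivot (R : realType) r (Q : 'M[R]_r) i :
  psd Q -> psd (schur_pivot Q i).
Proof.
move=> psdQ; have [Qs Q0] := psdQ; have Qji a b : Q a b = Q b a.
  by rewrite -[in LHS]Qs mxE.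
split=> [|u].
  by apply/matrixP => a b; rewrite mxE !schur_pivotE (Qji a b) (mulrC (Q i a)).
(* Completing the square: the form of the Schur complement at [u] is the form of [Q] at [u + t e_i]
   for this [t], the minimizer when the pivot is positive. *)
have := Q0 (u + (- (dot (row i Q) u) / Q i i) *: delta_mx ord0 i).
rewrite -!/(qform _ _) qformD_delta //.
have -> : qform (schur_pivot Q i) u =
    qform Q u - (Q i i)^-1 * dot (row i Q) u ^+ 2.
  have := qform_sum_outer (fun _ : 'I_1 => row i Q) u; rewrite !big_ord1 => <-.
  by rewrite /qform mulmxBr mulmxBl -scalemxAr -scalemxAl !mxE.
have [->|Qii] := eqVneq (Q i i) 0.
  by rewrite invr0 !mulr0 !mul0r !addr0 subr0.
by congr (_ <= _); field.
Qed.

(** Symmetric Gaussian elimination: after [k] pivots the first [k] rows of the remainder [P] vanish,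
    and each pivot has contributed one outer square. For [k] at least [r] the remainder is zero. *)
Lemma psd_outer_decomposition (R : realType) r (Q : 'M[R]_r) : psd Q ->
  exists s (c : 'I_s -> 'rV[R]_r), Q = \sum_i (c i)^T *m c i.
Proof.
move=> psdQ.
have [k le_rk] : {k | (r <= k)%N} by exists r.
suff [P [cs [psdP QE P0]]] : exists P (cs : seq 'rV[R]_r), [/\ psd P,
    Q = P + \sum_(c <- cs) c^T *m c & forall i j : 'I_r, (i < k)%N -> P i j = 0].
  exists (size cs), (fun i => tnth (in_tuple cs) i); rewrite QE big_tnth.
  rewrite (_ : P = 0) ?add0r //; apply/matrixP => i j; rewrite mxE.
  by apply: P0; rewrite (leq_trans (ltn_ord i)).
elim: k {le_rk} => [|k [P [cs [psdP QE P0]]]].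
  by exists Q, [::]; split=> //; rewrite big_nil addr0.
have [rk|kr] := leqP r k.
  by exists P, cs; split=> // i j _; apply: P0; rewrite (leq_trans (ltn_ord i)).
pose i0 := Ordinal kr; have Pii : 0 <= P i0 i0.
  by have := psd_qform_delta i0 i0 0 psdP;
    rewrite mulr0 mul0r expr0n /= mul0r !addr0.
(* The outer square of the new vector is the term that the pivot subtracts; both are zero if
   [P i0 i0 = 0]. *)
exists (schur_pivot P i0), ((Num.sqrt (P i0 i0)^-1 *: row i0 P) :: cs); split.
- exact: psd_schur_pivot.
- rewrite big_cons [(_ *: row _ _)^T]linearZ /= -scalemxAl -scalemxAr scalerA.
  by rewrite -expr2 sqr_sqrtr ?invr_ge0 // addrA subrK.
- move=> i j; rewrite ltnS leq_eqVlt schur_pivotE => /orP[/eqP ik|ik].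
    have -> : i = i0 by apply/val_inj.
    (* If the pivot is zero, its row was already zero by semidefiniteness. *)
    have [Pi0|Pi0] := eqVneq (P i0 i0) 0; last by field.
    by rewrite (psd_diag_eq0 _ psdP Pi0) !mulr0 subr0.
  rewrite (P0 i) // (_ : P i0 i = 0) ?mul0r ?mulr0 ?subr0 //.
  by rewrite -(proj1 psdP) mxE P0.
Qed.

(** The form at [e_j + e_i] and at [e_j - e_i] gives [2 |Q i j| <= Q i i + Q j j]. *)
Lemma psd_entry_le (R : realType) r (Q : 'M[R]_r) i j M : psd Q ->
  (forall k, Q k k <= M) -> `|Q i j| <= M.
Proof.
move=> psdQ hM; have := psd_qform_delta i j 1 psdQ.
have := psd_qform_delta i j (-1) psdQ; have := hM i; have := hM j.
rewrite ler_norml sqrrN expr1n => *; apply/andP; split; lra.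
Qed.

(** * Separation from the set of Gram-representable functionals *)

(** Take [X] of maximal rank among matrices with rows in [S]: appending another element of [S]
    cannot raise the rank, so the row space already contains it. *)
Lemma exists_spanning_rows (F : fieldType) r (S : set 'rV[F]_r) :
  exists d (X : 'M[F]_(d, r)),
    (forall i, S (row i X)) /\ forall v, S v -> (v <= X)%MS.
Proof.
pose A k := `[< exists d (X : 'M[F]_(d, r)),
  (forall i, S (row i X)) /\ \rank X = k >].
have A0 : exists k, A k.
  exists 0%N; apply/asboolP; exists 0%N, 0.
  by split=> [[]//|]; rewrite mxrank0.
have Ar k : A k -> (k <= r)%N.
  by move=> /asboolP[d [X [_ <-]]]; exact: rank_leq_col.
case: (ex_maxnP A0 Ar) => k /asboolP[d [X [SX rkX]]] kmax.
exists d, X; split=> // v Sv.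
have XXv : (X <= col_mx X v)%MS.
  by rewrite -addsmxE addsmxSl.
apply: (@submx_trans _ _ _ _ _ _ (col_mx X v)); first by rewrite -addsmxE addsmxSr.
rewrite -(mxrank_leqif_sup XXv) eqn_leq mxrankS //= rkX kmax //.
apply/asboolP; exists (d + 1)%N, (col_mx X v); split=> // i.
rewrite -(splitK i); case: (fintype.split i) => j /=.
  by rewrite -row_usubmx col_mxKu.
rewrite -row_dsubmx col_mxKd (_ : row j v = v) //.
by apply/rowP => l; rewrite mxE (ord1 j).
Qed.

Lemma qform_congr (R : realType) r s (Q : 'M[R]_r) (X : 'M[R]_(s, r)) u :
  qform (X *m Q *m X^T) u = qform Q (u *m X).
Proof. by rewrite /qform trmx_mul !mulmxA. Qed.

Lemma qformP (R : realType) r (u : 'rV[R]_r) a P Q :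
  qform (a *: P + Q) u = a * qform P u + qform Q u.
Proof.
by rewrite /qform mulmxDr mulmxDl -scalemxAr -scalemxAl [LHS]mxE [X in X + _]mxE.
Qed.

Lemma qform0 (R : realType) r (u : 'rV[R]_r) : qform 0 u = 0.
Proof. by rewrite /qform mulmx0 mul0mx mxE. Qed.

Lemma qformZ (R : realType) r (u : 'rV[R]_r) a Q :
  qform (a *: Q) u = a * qform Q u.
Proof. by rewrite -[a *: Q]addr0 qformP qform0 addr0. Qed.

Lemma closed_linear_eq (R : realType) n (f : 'rV[R]_n -> R) c :
  linear_for *%R f -> closed [set z | f z = c].
Proof.
by move=> /linear_continuous_rV/continuous_closedP/(_ _ (@closed_eq _ c)); apply.
Qed.

Lemma closed_linear_ge (R : realType) n (f : 'rV[R]_n -> R) c :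
  linear_for *%R f -> closed [set z | c <= f z].
Proof.
by move=> /linear_continuous_rV/continuous_closedP/(_ _ (@closed_ge _ c)); apply.
Qed.

(** The set [K] for general affine data in [y]; the sum-of-squares case has [b x = p(x)^2] and
    [a x = - p(x)^2 x]. *)
Definition gram_set (R : realType) (T : Type) n r (E : set T)
    (w : T -> 'rV[R]_r) (a : T -> 'rV[R]_n) (b : T -> R) : set 'rV[R]_n :=
  [set y | exists2 Q : 'M[R]_r, psd Q &
    forall x, E x -> b x + dot (a x) y = qform Q (w x)].

Lemma convex_gram_set (R : realType) (T : Type) n r (E : set T)
    (w : T -> 'rV[R]_r) (a : T -> 'rV[R]_n) (b : T -> R) :
  convex_set (gram_set E w a b).
Proof.
apply/convex_setE => y z t [P psdP hP] [Q psdQ hQ] /andP[t0 t1].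
exists (t *: P + (1 - t) *: Q) => [|x Ex].
  by apply: psdD; apply: psdZ => //; rewrite subr_ge0.
rewrite qformP qformZ -hP // -hQ // dotDr !dotZr; ring.
Qed.

(* The Gram matrix in the coordinates of finitely many values [w (t j)] that
   span all the [w x] has prescribed diagonal, so it ranges over a compact set
   when [y] does. *)
Lemma gram_set_coordinates (R : realType) (T : Type) n r (E : set T)
    (w : T -> 'rV[R]_r) (a : T -> 'rV[R]_n) (b : T -> R) :
  exists d (v : T -> 'rV[R]_d) (t : 'I_d -> T), gram_set E w a b =
    [set y | exists Q : 'M[R]_d, [/\ psd Q,
      forall x, E x -> qform Q (v x) - dot (a x) y = b x &
      forall j, Q j j - dot (a (t j)) y = b (t j)]].
Proof.
have [d [X [SX spX]]] := exists_spanning_rows (w @` E).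
have /choice[t tP] : forall j, exists x, E x /\ w x = row j X.
  by move=> j; have [x] := SX j; exists x.
(* Since [w x] is in the row space of [X], the row [w x *m pinvmx X] gives coordinates of it over
   the rows of [X]. *)
have wX x : E x -> w x *m pinvmx X *m X = w x.
  by move=> Ex; rewrite mulmxKpV // spX //; exists x.
exists d, (fun x => w x *m pinvmx X), t.
apply/seteqP; split=> [y [Q psdQ hQ]|y [Q [psdQ hQ _]]].
  exists (X *m Q *m X^T); split=> [|x Ex|j]; first exact: psd_congr.
    by rewrite qform_congr wX // -hQ // addrK.
  (* The diagonal entry [j] of [X *m Q *m X^T] is the value of the old form at [row j X], that is at
     [w (t j)]. *)
  have [Et wt] := tP j.
  by rewrite -qform_delta qform_congr -rowE -wt -hQ // addrK.
exists (pinvmx X *m Q *m (pinvmx X)^T) => [|x Ex]; first exact: psd_congr.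
by rewrite qform_congr -hQ // subrK.
Qed.

(** The distance is minimized over pairs of a Gram matrix and a point no farther from [y] than a
    given [k0]. These pairs form a compact set: a bounded point bounds the diagonal of the matrix,
    and semidefiniteness then bounds all its entries. *)
Lemma gram_set_nearest (R : realType) (T : Type) n r (E : set T)
    (w : T -> 'rV[R]_r) (a : T -> 'rV[R]_n) (b : T -> R) (y : 'rV[R]_n) :
  gram_set E w a b !=set0 ->
  exists2 k, gram_set E w a b k & forall z, gram_set E w a b z ->
    dot (y - k) (y - k) <= dot (y - z) (y - z).
Proof.
have [d [v [t ->]]] := gram_set_coordinates E w a b.
move=> [k0 [Q0 [psdQ0 hQ0 dQ0]]].
(* A pair of a matrix and a point is stored as a single row vector. *)
pose Q (z : 'rV[R]_(d * d + n)) : 'M[R]_d := vec_mx (lsubmx z).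
pose Y (z : 'rV[R]_(d * d + n)) : 'rV[R]_n := rsubmx z.
have QE z i j : Q z i j = z ord0 (lshift n (mxvec_index i j)) by rewrite !mxE.
have YE z i : Y z ord0 i = z ord0 (rshift (d * d) i) by rewrite !mxE.
have QP s z1 z2 : Q (s *: z1 + z2) = s *: Q z1 + Q z2.
  by apply/matrixP => i j; rewrite QE !mxE.
have YP s z1 z2 : Y (s *: z1 + z2) = s *: Y z1 + Y z2.
  by apply/matrixP => i j; rewrite !mxE.
pose M := dot (y - k0) (y - k0).
pose D z := dot (y - Y z) (y - Y z).
have cD : continuous D.
  apply: continuous_sqdist => i.
  rewrite [X in continuous X](_ : _ =
      fun z : 'rV[R]_(d * d + n) => z ord0 (rshift (d * d) i)).
    exact: coord_continuous.
  exact/funext.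
pose S := [set z | [/\ psd (Q z),
  forall x, E x -> qform (Q z) (v x) - dot (a x) (Y z) = b x,
  forall j, Q z j j - dot (a (t j)) (Y z) = b (t j) & D z <= M]].
have clS : closed S.
  have -> : S = (\bigcap_(i in setT) \bigcap_(j in setT)
      [set z | Q z i j - Q z j i = 0])
    `&` (\bigcap_(u in setT) [set z | 0 <= qform (Q z) u])
    `&` (\bigcap_(x in E) [set z | qform (Q z) (v x) - dot (a x) (Y z) = b x])
    `&` (\bigcap_(j in setT) [set z | Q z j j - dot (a (t j)) (Y z) = b (t j)])
    `&` [set z | D z <= M].
    apply/seteqP; split=> z.
      move=> [[Qs Qp] h1 h2 h3]; split=> //; split=> [|j _]; last exact: h2.
      split=> [|x Ex]; last exact: h1.
      split=> [i _ j _ /=|u _]; last exact: Qp.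
      by rewrite -{1}Qs mxE subrr.
    move=> [[[[h1 h2] h3] h4] h5].
    split; [|exact: h3|by move=> j; exact: h4|exact: h5].
    split=> [|u]; last exact: h2.
    by apply/matrixP => i j; rewrite mxE; apply/eqP; rewrite -subr_eq0 (h1 j _ i).
  do ![apply: closedI].
  - apply: closed_bigI => i _; apply: closed_bigI => j _; apply: closed_linear_eq.
    move=> s z1 z2; rewrite QP !mxE; ring.
  - apply: closed_bigI => u _; apply: closed_linear_ge.
    by move=> s z1 z2; rewrite QP qformP.
  - apply: closed_bigI => x _; apply: closed_linear_eq.
    move=> s z1 z2; rewrite QP YP qformP dotDr dotZr; ring.
  - apply: closed_bigI => j _; apply: closed_linear_eq.
    move=> s z1 z2; rewrite QP YP dotDr dotZr !mxE; ring.
  - by move/continuous_closedP: cD => /(_ _ (@closed_le _ M)).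
have coS : compact S.
  (* [M + 1] bounds any number whose square is at most [M]; [B2] sums over all [j], so that one
     constant bounds every diagonal entry. *)
  pose B1 := M + 1 + \sum_i `|y ord0 i|.
  pose B2 := \sum_j (`|b (t j)| + \sum_i `|a (t j) ord0 i| * B1).
  have M0 : 0 <= M by exact: dotxx_ge0.
  have B1_ge0 : 0 <= B1 by rewrite !addr_ge0 // sumr_ge0.
  have B2_ge0 : 0 <= B2.
    by apply: sumr_ge0 => j _; rewrite addr_ge0 // sumr_ge0 // => i _;
      rewrite mulr_ge0.
  have YB z i : S z -> `|Y z ord0 i| <= B1.
    move=> [_ _ _ Dz].
    have h : (y ord0 i - Y z ord0 i) ^+ 2 <= M.
      apply: le_trans Dz; rewrite /D /dot (bigD1 i) //= !mxE -expr2 lerDl.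
      by apply: sumr_ge0 => k _; rewrite -expr2 sqr_ge0.
    have -> : Y z ord0 i = - (y ord0 i - Y z ord0 i) + y ord0 i by ring.
    apply: (le_trans (ler_normD _ _)); rewrite lerD //.
      rewrite ler_norml; apply/andP; split; nra.
    by rewrite (bigD1 i) //= lerDl sumr_ge0.
  have QB z i j : S z -> `|Q z i j| <= B2.
    move=> Sz; have [psdQ _ dQ _] := Sz; apply: psd_entry_le => // k.
    rewrite -[Q z k k](subrK (dot (a (t k)) (Y z))) dQ.
    rewrite /B2 (bigD1 k) //= ler_wpDr //.
      by apply: sumr_ge0 => l _; rewrite addr_ge0 // sumr_ge0 // => ? _;
        rewrite mulr_ge0.
    rewrite lerD ?ler_norm // ler_sum // => l _.
    by rewrite (le_trans (ler_norm _)) // normrM ler_wpM2l // YB.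
  apply: (@compact_rV_box _ _ _ (B1 + B2)) => // z i Sz.
  rewrite -(splitK i); case: (fintype.split i) => [k|k] /=.
    case/mxvec_indexP: k => i1 j1; rewrite -QE.
    by rewrite (le_trans (QB _ _ _ Sz)) // lerDr.
  by rewrite -YE (le_trans (YB _ _ Sz)) // lerDl.
have S0 : S !=set0.
  exists (row_mx (mxvec Q0) k0).
  by rewrite /S /= /D /Q /Y row_mxKl row_mxKr mxvecK.
have [|z Sz zmin] := compact_EVT_min S0 coS (_ : {within S, continuous D}).
  exact/continuous_subspaceT.
rewrite inE in Sz; have [psdQ hQ dQ Dz] := Sz.
exists (Y z); first by exists (Q z).
move=> k [Qk [psdQk hQk dQk]].
(* Points farther away than [k0] lie outside the compact set, but the minimum is at most [M]. *)
have [kM|kM] := leP (dot (y - k) (y - k)) M; last first.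
  exact: le_trans Dz (ltW kM).
pose zk := row_mx (mxvec Qk) k.
have QkE : Q zk = Qk by rewrite /Q row_mxKl mxvecK.
have YkE : Y zk = k by rewrite /Y row_mxKr.
rewrite -[k]YkE -/(D zk) zmin // inE /S /= QkE YkE; split=> //.
by rewrite /D YkE.
Qed.

Lemma gram_set_separation (R : realType) (T : Type) n r (E : set T)
    (w : T -> 'rV[R]_r) (a : T -> 'rV[R]_n) (b : T -> R) (y : 'rV[R]_n) :
  ~ gram_set E w a b y ->
  exists (c : 'rV[R]_n) e,
    e < dot c y /\ forall z, gram_set E w a b z -> dot c z <= e.
Proof.
move=> nKy; have [K0|/set0P/negP/negPn/eqP K0] := pselect (gram_set E w a b !=set0).
  have [k Kk kmin] := gram_set_nearest y K0.
  exact: nearest_point_separation (@convex_gram_set _ _ _ _ E w a b) Kk nKy kmin.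
by exists 0, (-1); rewrite K0 dotC dot0r; split=> //; rewrite ltrN10.
Qed.

(** * Sums of squares modulo a convex radical ideal *)

(** The constant [c] is the value at the origin. If it is positive, dividing by it gives a slack
    function; if it is zero, the values at small positive and negative multiples of the basis
    vectors force [b = 0]. *)
Lemma affine_ge0_polar (R : realType) n (C : set 'rV[R]_n) c (b : 'rV[R]_n) :
  interior C 0 -> (forall x, C x -> 0 <= c + dot b x) ->
  (c = 0 /\ b = 0) \/ (0 < c /\ polar C (- c^-1 *: b)).
Proof.
move=> /interior0_box[e e0 eC] cb_ge0.
have c0 : 0 <= c.
  have := cb_ge0 0; rewrite dot0r addr0; apply.
  by apply: eC => i; rewrite mxE normr0 ltW.
have [c_gt0|c_le0] := ltP 0 c; [right|left].
  split=> // x Cx; rewrite dotZr dotC mulNr -mulrN.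
  by rewrite ler_pdivrMl // mulr1 -subr_ge0 opprK cb_ge0.
have c_eq0 : c = 0 by apply/le_anti; rewrite c0 c_le0.
split=> //; apply/rowP => i; rewrite mxE; rewrite c_eq0 in cb_ge0.
have h s : `|s| = 1 -> 0 <= s * b ord0 i.
  move=> s1; have := cb_ge0 (s *: (e *: delta_mx ord0 i)).
  rewrite add0r !dotZr dot_delta mulrCA (pmulr_rge0 _ e0); apply.
  by apply: eC => j; rewrite mxE normrM s1 mul1r normr_delta // ltW.
have := h 1; have := h (-1); rewrite normrN normr1 mulN1r mul1r oppr_ge0.
by move=> /(_ erefl) h1 /(_ erefl) h2; apply/le_anti; rewrite h1 h2.
Qed.

Lemma polar_sub_gram_set (R : realType) (T : Type) n r (C : set 'rV[R]_n)
    (E : set T) (w : T -> 'rV[R]_r) (a : T -> 'rV[R]_n) (b : T -> R) :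
  interior C 0 -> ext (polar C) `<=` gram_set E w a b ->
  polar C `<=` gram_set E w a b.
Proof.
move=> C0 extK y Cy; apply: contrapT => /gram_set_separation[c [e [ey ce]]].
have [|z /extK/ce ze zmax] := ext_argmax_dot c (compact_polar C0); first by exists y.
by have := zmax y Cy; rewrite leNgt (le_lt_trans ze).
Qed.

Lemma sub_closed_halfspaces (R : realType) n (C : set 'rV[R]_n) x :
  compact C -> convex_set C ->
  (forall c b, (forall z, C z -> 0 <= c + dot b z) -> 0 <= c + dot b x) -> C x.
Proof.
move=> coC cC h; apply: contrapT => /(compact_convex_separation coC cC).
move=> [a [e [ex ae]]].
suff : 0 <= e + dot (- a) x by rewrite dotNl leNgt subr_lt0 ex.
by apply: h => z Cz; rewrite dotNl subr_ge0 ae.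
Qed.

(** Cyclicity of the trace turns the pairing with a rank-one matrix into a quadratic form; this
    links factorizations to Gram matrices. *)
Lemma trace_outer_mul (R : realType) r (v : 'cV[R]_r) (B : 'M[R]_r) :
  \tr (v *m v^T *m B) = qform B v^T.
Proof. by rewrite -mulmxA mxtrace_mulC /qform trmxK /mxtrace big_ord1. Qed.

Lemma linear_poly_affine (R : realType) n (l : mpoly n R) : linear_poly l ->
  exists c b, forall x, peval l x = c + dot b x.
Proof.
move=> /mpolywE->; elim/big_ind: _ => [|p q [c [b hp]] [d [e hq]]|[m /= dm] _].
- by exists 0, 0 => x; rewrite /peval meval0 dotC dot0r addr0.
- exists (c + d), (b + e) => x.
  rewrite /peval mevalD -!/(peval _ _) hp hq dotDl; ring.
set a := mcoeff _ _; have [m0|m0] := eqVneq (mdeg m) 0%N.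
  exists a, 0 => x; move/eqP: m0; rewrite mdeg_eq0 => /eqP->.
  by rewrite dotC dot0r addr0 mpolyX0 /peval mevalZ meval1 mulr1.
have /mdeg1P[i /eqP->] : mdeg m == 1%N by rewrite eqn_leq -ltnS dm lt0n.
exists 0, (a *: delta_mx ord0 i) => x.
by rewrite /peval mevalZ mevalXU add0r dotZl dotC dot_delta.
Qed.

Definition affine_mpoly (R : realType) n c (b : 'rV[R]_n) : mpoly n R :=
  mpolyC n c + \sum_i b ord0 i *: mpolyX R (mnm1 i).

Lemma peval_affine (R : realType) n c (b : 'rV[R]_n) x :
  peval (affine_mpoly c b) x = c + dot b x.
Proof.
rewrite /peval mevalD mevalC raddf_sum /=; congr (_ + _).
by apply: eq_bigr => i _; rewrite mevalZ mevalXU.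
Qed.

Lemma deg_le_sum (R : realType) n k (T : Type) (s : seq T) (P : pred T)
    (h : T -> mpoly n R) :
  (forall i, deg_le k (h i)) -> deg_le k (\sum_(i <- s | P i) h i).
Proof.
move=> dh; rewrite /deg_le; elim/big_ind: _ => [|p q dp dq|i _]; last exact: dh.
  by rewrite mmeasure0.
by rewrite (leq_trans (msizeD_le _ _)) // geq_max dp dq.
Qed.

Lemma deg_leZ (R : realType) n k a (h : mpoly n R) :
  deg_le k h -> deg_le k (a *: h).
Proof. by move=> dh; rewrite /deg_le (leq_trans (msizeZ_le _ _)). Qed.

Lemma linear_affine (R : realType) n c (b : 'rV[R]_n) :
  linear_poly (affine_mpoly c b).
Proof.
rewrite /linear_poly /deg_le (leq_trans (msizeD_le _ _)) // geq_max msizeC.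
rewrite (leq_trans (leq_b1 _)) //; apply: (@deg_le_sum _ _ 1) => i.
by apply: deg_leZ; rewrite /deg_le msizeX mdeg1.
Qed.

Definition weval (R : realType) n r (w : 'I_r -> mpoly n R) (x : 'rV[R]_n) :
    'rV[R]_r := (vec_eval w x)^T.

Lemma peval_lin_comb (R : realType) n r (w : 'I_r -> mpoly n R) c x :
  peval (\sum_j c j *: w j) x = dot (\row_j c j) (weval w x).
Proof.
rewrite /peval raddf_sum; apply: eq_bigr => j _.
by rewrite /= mevalZ !mxE.
Qed.

Section ConvexRadicalIdeal.
Context (R : realType) (n : nat) (I : set (mpoly n R)).
Let Z := real_zeros I.
Let C := convex_hull Z.
Context (crI : convex_radical I).

(** Extreme points of the hull already lie in [Z], so intersecting them with [Z] changes nothing. *)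
Lemma mem_convex_radical p :
  I p <-> forall x, ext C x -> peval p x = 0.
Proof.
rewrite crI; split=> [Ip x Cx|h x [_ Cx]]; last exact: h.
by apply: Ip; split=> //; exact: ext_convex_hull.
Qed.

(** The Gram matrix method: squares of combinations with coefficient rows [c i] add up to the form
    of [\sum_i (c i)^T *m c i] at [w], and every semidefinite matrix has this shape. Congruence
    modulo [I] is equality on [ext C]. *)
Lemma sos_mod_lin_combsP r (w : 'I_r -> mpoly n R) q :
  sos_mod I (lin_combs w) q <->
  exists2 Q : 'M[R]_r, psd Q &
    forall x, ext C x -> peval q x = qform Q (weval w x).
Proof.
have sosE s (h : 'I_s -> mpoly n R) x :
    peval (q - \sum_i h i ^+ 2) x = peval q x - \sum_i peval (h i) x ^+ 2.
  rewrite /peval mevalB [meval _ (\sum_i _)]raddf_sum /=; congr (_ - _).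
  by apply: eq_bigr => i _; rewrite rmorphXn.
split=> [[s [h [/choice[c hc] /mem_convex_radical Ih]]]|[Q psdQ hQ]].
  exists (\sum_i (\row_j c i j)^T *m \row_j c i j); first exact: psd_sum_outer.
  move=> x /Ih/eqP; rewrite sosE subr_eq0 qform_sum_outer => /eqP ->.
  by apply: eq_bigr => i _; rewrite hc peval_lin_comb.
have [s [c cE]] := psd_outer_decomposition psdQ.
exists s, (fun i => \sum_j c i ord0 j *: w j); split.
  by move=> i; exists (fun j => c i ord0 j).
apply/mem_convex_radical => x Cx; rewrite sosE hQ // cE qform_sum_outer.
apply/eqP; rewrite subr_eq0; apply/eqP; apply: eq_bigr => i _.
by rewrite peval_lin_comb (_ : \row_j c i ord0 j = c i) //; apply/rowP => j; rewrite mxE.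
Qed.

Definition sos_functionals p r (w : 'I_r -> mpoly n R) : set 'rV[R]_n :=
  gram_set (ext C) (weval w) (fun x => - (peval p x ^+ 2) *: x)
    (fun x => peval p x ^+ 2).

Lemma sos_functionalsP p r (w : 'I_r -> mpoly n R) y :
  sos_functionals p w y <->
  exists2 Q : 'M[R]_r, psd Q &
    forall x, ext C x -> peval p x ^+ 2 * slack x y = qform Q (weval w x).
Proof.
have e x : peval p x ^+ 2 + dot (- (peval p x ^+ 2) *: x) y =
    peval p x ^+ 2 * slack x y.
  by rewrite dotZl /slack; ring.
by split=> -[Q psdQ hQ]; exists Q => // x Cx; move: (hQ x Cx); rewrite e.
Qed.

Lemma nonneg_on_hull c b : (forall x, Z x -> 0 <= c + dot b x) ->
  forall x, C x -> 0 <= c + dot b x.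
Proof.
move=> h x Cx; suff: dot (- b) x <= c by rewrite dotNl -subr_ge0 opprK.
apply: (convex_hull_sub (@convex_halfspace _ _ (- b) c) _ Cx) => z Zz /=.
by rewrite dotNl -subr_ge0 opprK h.
Qed.

(** Here [l] is [c] times the slack at [- c^-1 *: b], so it suffices to multiply the Gram matrix by
    [c]; the converse below divides by [c]. *)
Lemma sos_functionals_affine p r (w : 'I_r -> mpoly n R) c b l :
  sos_functionals p w (- c^-1 *: b) -> 0 < c ->
  (forall x, peval l x = c + dot b x) -> sos_mod I (lin_combs w) (p ^+ 2 * l).
Proof.
move=> /sos_functionalsP[Q psdQ hQ] c0 hl; apply/sos_mod_lin_combsP.
exists (c *: Q) => [|x Cx]; first by apply: psdZ => //; exact: ltW.
rewrite qformZ -hQ //.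
rewrite /peval mevalM rmorphXn /= -!/(peval _ _) hl /slack dotZr (dotC x).
by field; rewrite gt_eqF.
Qed.

Lemma affine_sos_functionals p r (w : 'I_r -> mpoly n R) c b l :
  sos_mod I (lin_combs w) (p ^+ 2 * l) -> 0 < c ->
  (forall x, peval l x = c + dot b x) -> sos_functionals p w (- c^-1 *: b).
Proof.
move=> /sos_mod_lin_combsP[Q psdQ hQ] c0 hl; apply/sos_functionalsP.
exists (c^-1 *: Q) => [|x Cx]; first by apply: psdZ => //; rewrite invr_ge0 ltW.
rewrite qformZ -hQ //.
rewrite /peval mevalM rmorphXn /= -!/(peval _ _) hl /slack dotZr (dotC x).
by field; rewrite gt_eqF.
Qed.

Context (C0 : interior C 0).

Lemma polar_sub_sos_functionalsP p r (w : 'I_r -> mpoly n R) :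
  polar C `<=` sos_functionals p w <->
  forall l, linear_poly l -> (forall x, Z x -> 0 <= peval l x) ->
    sos_mod I (lin_combs w) (p ^+ 2 * l).
Proof.
split=> [CK l /linear_poly_affine[c [b hl]] l0|h y Cy].
  have cb0 : forall x, C x -> 0 <= c + dot b x.
    by apply: nonneg_on_hull => x /l0; rewrite hl.
  (* In the degenerate case [l] vanishes everywhere and the zero Gram matrix serves. *)
  have [[c0 b0]|[c0 /CK Kb]] := affine_ge0_polar C0 cb0; last first.
    exact: sos_functionals_affine hl.
  apply/sos_mod_lin_combsP; exists 0 => [|x Cx].
    by split=> [|u]; rewrite ?trmx0 // mulmx0 mul0mx mxE.
  rewrite qform0 /peval mevalM -!/(peval _ _) hl c0 b0.
  by rewrite dotC dot0r addr0 mulr0.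
(* The polynomial [1 - <y, x>] has [c = 1] and [b = - y], so that [- c^-1 *: b] is [y] itself. *)
have := @affine_sos_functionals p r w 1 (- y) (affine_mpoly 1 (- y)).
rewrite invr1 scaleN1r opprK; apply=> // [|x]; last exact: peval_affine.
apply: h => [|x Zx]; first exact: linear_affine.
by rewrite peval_affine dotNl subr_ge0 dotC Cy //; exact: sub_convex_hull.
Qed.

(** The trace of [A x *m B y] is [p(x)^-2] times the form of [B y] at [w(x)], so the matrices [B y]
    are Gram matrices for [p^2] times the slack. A factorization provides them at extreme points,
    and [polar_sub_gram_set] extends this to the whole polar. *)
Lemma rational_factorizationP p r (w : 'I_r -> mpoly n R) :
  (forall x, ext C x -> peval p x <> 0) ->
  has_rational_factorization C p w <-> polar C `<=` sos_functionals p w.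
Proof.
move=> p0; have traceE x B :
    \tr ((peval p x ^+ 2)^-1 *: (vec_eval w x *m (vec_eval w x)^T) *m B) =
    (peval p x ^+ 2)^-1 * qform B (weval w x).
  by rewrite -scalemxAl mxtraceZ trace_outer_mul.
have p2 x : ext C x -> peval p x ^+ 2 != 0.
  by move=> /p0/eqP; rewrite sqrf_eq0.
split=> [[A [B [[psdA psdB AB] AE]]]|CK].
  apply: polar_sub_gram_set => // y Cy; apply/sos_functionalsP.
  exists (B y) => [|x Cx]; first exact: psdB.
  by rewrite AB // AE // traceE mulVKf // p2.
(* Outside [ext (polar C)] the zero matrix is the default value. *)
have /choice[B hB] : forall y, exists Q : 'M[R]_r, ext (polar C) y -> psd Q /\
    forall x, ext C x -> peval p x ^+ 2 * slack x y = qform Q (weval w x).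
  move=> y; have [[Cy _]|nCy] := pselect (ext (polar C) y); last by exists 0.
  by have /sos_functionalsP[Q psdQ hQ] := CK y Cy; exists Q.
exists (fun x => (peval p x ^+ 2)^-1 *: (vec_eval w x *m (vec_eval w x)^T)), B.
split=> //; split=> [x Cx|y /hB[]//|x y Cx /hB[_ hQ]].
  apply: psdZ; first by rewrite invr_ge0 sqr_ge0.
  by have := psd_sum_outer (fun _ : 'I_1 => weval w x); rewrite big_ord1 trmxK.
by rewrite traceE -hQ // mulKf // p2.
Qed.

(** * Theta bodies and polynomial factorizations *)

Lemma ksos_ge0 k l x : linear_poly l -> ksos_mod k I l -> C x -> 0 <= peval l x.
Proof.
move=> /linear_poly_affine[c [b hl]] [s [h [_ Ih]]] Cx; rewrite hl.
apply: nonneg_on_hull Cx => z /(_ _ Ih).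
rewrite -hl /peval mevalB [meval _ (\sum_i _)]raddf_sum /= => /subr0_eq ->.
by apply: sumr_ge0 => i _; rewrite rmorphXn sqr_ge0.
Qed.

(** Affine inequalities valid on the compact convex set [C] cut it out, and each is a sum of squares
    of combinations of [w], hence [k]-sos. The other inclusion is [ksos_ge0]. *)
Lemma polynomial_factorization_theta_body k r (w : 'I_r -> mpoly n R) :
  compact C -> (forall j, deg_le k (w j)) -> polar C `<=` sos_functionals 1 w ->
  theta_body k I = C.
Proof.
move=> coC dw /polar_sub_sos_functionalsP hw; apply/seteqP; split=> x; last first.
  by move=> Cx l [ll kl]; exact: ksos_ge0 kl Cx.
move=> thx; apply: sub_closed_halfspaces => // [|c b cb0].
  exact: convex_hull_convex.
rewrite -peval_affine; apply: thx; split; first exact: linear_affine.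
have [||s [h [hh Ih]]] := hw (affine_mpoly c b); first exact: linear_affine.
  by move=> z Zz; rewrite peval_affine cb0 //; exact: sub_convex_hull.
exists s, h; split; last by rewrite expr1n mul1r in Ih.
by move=> i; have [d ->] := hh i; apply: deg_le_sum => j; exact: deg_leZ.
Qed.

(** [bmultinom n k.+1] consists of the exponents of degree strictly below [k.+1], that is at most
    [k]. *)
Definition monomials k (j : 'I_#|{: bmultinom n k.+1}|) : mpoly n R :=
  mpolyX R (enum_val j).

Lemma deg_le_monomials k (j : 'I_#|{: bmultinom n k.+1}|) :
  deg_le k (monomials j).
Proof. by rewrite /deg_le msizeX bmdeg. Qed.

Lemma lin_combs_monomials k h : deg_le k h -> lin_combs (@monomials k) h.
Proof.
move=> dh; exists (fun j => mcoeff (enum_val j : bmultinom n k.+1) h).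
rewrite [LHS](mpolywE dh).
by rewrite (reindex (@enum_val (bmultinom n k.+1) predT)) //;
  exact/onW_bij/enum_val_bij.
Qed.

Lemma ksos_mod_lin_combs k q :
  ksos_mod k I q -> sos_mod I (lin_combs (@monomials k)) q.
Proof.
by move=> [s [h [hh Ih]]]; exists s, h; split=> // i; exact: lin_combs_monomials.
Qed.

(* Otherwise a hyperplane separating some [y] of the polar from the closed
   convex set of sum-of-squares functionals, scaled so as to be at most 1 on the
   latter, is a point of the theta body outside [C]. *)
Lemma theta_body_sos_functionals k :
  theta_body k I = C -> polar C `<=` sos_functionals 1 (@monomials k).
Proof.
move=> thC y Cy; apply: contrapT => /gram_set_separation[c [e [ey ce]]].
(* The origin is a sum-of-squares functional: its slack is the constant 1, the square of a
   polynomial of degree 0. *)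
have e0 : 0 <= e.
  rewrite -(dot0r c); apply: ce; apply/sos_functionalsP.
  have : sos_mod I (lin_combs (@monomials k)) 1.
    exists 1%N, (fun=> 1); split=> [_|].
      by apply: lin_combs_monomials; rewrite /deg_le msize1.
    by rewrite big_ord1 expr1n subrr; apply/mem_convex_radical => x _; exact: meval0.
  move=> /sos_mod_lin_combsP[Q psdQ hQ]; exists Q => // x Cx.
  by rewrite /slack dot0r subr0 mulr1 -hQ // /peval meval1 expr1n.
(* A value strictly between [e] and [dot c y] is positive even if [e = 0], so [c] can be divided by
   it. *)
pose g := (e + dot c y) / 2.
have eg : e < g by rewrite /g; lra.
have gy : g < dot c y by rewrite /g; lra.
have g0 : 0 < g by exact: le_lt_trans eg.
have Cx0 : C (g^-1 *: c).
  rewrite -thC => l [ll kl] /=.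
  have [d [b hl]] := linear_poly_affine ll.
  have db0 : forall x, C x -> 0 <= d + dot b x.
    by move=> x Cx; rewrite -hl; exact: ksos_ge0 kl Cx.
  rewrite hl; have [[-> ->]|[d0 _]] := affine_ge0_polar C0 db0.
    by rewrite dotC dot0r addr0.
  (* A [k]-sos inequality yields a sum-of-squares functional, on which [c] is at most [e < g];
     multiplied by [d / g] this bound says that [l] is nonnegative at [g^-1 *: c]. *)
  have /ce : sos_functionals 1 (@monomials k) (- d^-1 *: b).
    apply: affine_sos_functionals d0 hl.
    by rewrite expr1n mul1r; exact: ksos_mod_lin_combs.
  rewrite dotZr dotZr (dotC b) => h.
  have h1 : d^-1 * - dot c b <= g by lra.
  move: h1; rewrite ler_pdivrMl // => h1.
  have -> : g^-1 * dot c b = - (g^-1 * - dot c b) by ring.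
  by rewrite subr_ge0 ler_pdivrMl // mulrC.
have := Cy _ Cx0; rewrite dotZl ler_pdivrMl // mulr1; lra.
Qed.

End ConvexRadicalIdeal.

Theorem theorem5p6 (R : realType) (n : nat) (I : set (mpoly n R))
    (Z := real_zeros I) (C := convex_hull Z) :
  is_ideal I -> convex_radical I -> compact C -> interior C 0 ->
  (forall (p : mpoly n R) (k : nat) (w : 'I_k -> mpoly n R),
     (forall x, ext C x -> peval p x <> 0) ->
     (has_rational_factorization C p w <->
      forall l : mpoly n R, linear_poly l ->
        (forall x, Z x -> 0 <= peval l x) ->
        sos_mod I (lin_combs w) (p ^+ 2 * l)))
  /\
  (forall k : nat,
     (exists (r : nat) (w : 'I_r -> mpoly n R),
        (forall j, deg_le k (w j)) /\ has_polynomial_factorization C w) <->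
     theta_body k I = C).
Proof.
move=> _ crI coC C0; split=> [p k w p0|k].
  by rewrite (rational_factorizationP C0) // (polar_sub_sos_functionalsP crI C0).
have one_neq0 x : ext C x -> peval (1 : mpoly n R) x <> 0.
  by move=> _; rewrite /peval meval1; exact/eqP/oner_neq0.
split=> [[r [w [dw /(rational_factorizationP C0 _ one_neq0)]]]|thC].
  exact: polynomial_factorization_theta_body.
exists _, (@monomials R n k); split; first exact: deg_le_monomials.
apply/(rational_factorizationP C0 _ one_neq0).
exact: theta_body_sos_functionals.
Qed.
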